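(* Let $\lambda_1,\ldots,\lambda_n\in(0,1)$, let $p_1,\ldots,p_n\in\mathbb{R}^d$, let $f_j(x)=\lambda_j x+(1-\lambda_j)p_j$ for $1\le j\le n$, and let $\Lambda\subset\mathbb{R}^d$ be the attractor of $\{f_j\}_{j=1}^n$. Assume $\sum_{j=1}^{n}\lambda_j^d\neq 1$ and $\mathcal{L}(\Lambda)>0$. Then Lebesgue almost every $x\in\Lambda$ has a continuum of codings, i.e. the set of codings of $x$ has cardinality $2^{\aleph_0}$.
   Context: The attractor $\Lambda$ of $\{f_j\}_{j=1}^n$ is the unique nonempty compact set $\Lambda\subset\mathbb{R}^d$ with $\Lambda=\bigcup_{j=1}^n f_j(\Lambda)$. A coding of $x\in\Lambda$ is a sequence $(\epsilon_i)_{i=1}^\infty\in\{1,\ldots,n\}^{\mathbb{N}}$ such that $\lim_{N\to\infty}f_{\epsilon_1}\cdots f_{\epsilon_N}(0)=x$, where $f_{\epsilon_1}\cdots f_{\epsilon_N}$ denotes the composition $f_{\epsilon_1}\circ\cdots\circ f_{\epsilon_N}$. $\mathcal{L}$ denotes $d$-dimensional Lebesgue measure. *)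

(* Defs.v *)
From HB Require Import structures.
From mathcomp Require Import all_boot all_order all_algebra.
From mathcomp Require Import all_classical all_reals all_analysis.

Set Implicit Arguments.
Unset Strict Implicit.
Unset Printing Implicit Defensive.

Import Order.TTheory GRing.Theory Num.Theory.
Import numFieldNormedType.Exports.

Local Open Scope classical_set_scope.
Local Open Scope ring_scope.

Section lebesgue_rV.
Context (R : realType) (d : nat).
Local Open Scope ereal_scope.

(* [Some (a, b)] codes the half-open box ]a_1, b_1] x ... x ]a_d, b_d]; [None]
   codes the empty set, which is not of that form when d = 0. *)
Definition box (I : option ('rV[R]_d * 'rV[R]_d)) : set 'rV[R]_d :=
  if I is Some (a, b) then
    [set x | forall i : 'I_d, (a 0 i < x 0 i <= b 0 i)%R]
  else set0.

Definition box_volume (I : option ('rV[R]_d * 'rV[R]_d)) : \bar R :=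
  if I is Some (a, b) then
    (\prod_(i < d) Num.max 0 (b 0 i - a 0 i))%R%:E
  else 0.

Definition box_cover (A : set 'rV[R]_d)
    : set (nat -> option ('rV[R]_d * 'rV[R]_d)) :=
  [set I | A `<=` \bigcup_k box (I k)].

Definition lebesgue_outer (A : set 'rV[R]_d) : \bar R :=
  ereal_inf [set \sum_(k <oo) box_volume (I k) | I in box_cover A].

Lemma box_volume_ge0 I : 0 <= box_volume I.
Proof.
case: I => [[a b]|] //=; rewrite lee_fin prodr_ge0// => i _.
by rewrite le_max lexx.
Qed.

Lemma lebesgue_outer_ge0 A : 0 <= lebesgue_outer A.
Proof.
apply: le_ereal_inf_tmp => _ [I _ <-].
by apply: nneseries_ge0 => k _ _; exact: box_volume_ge0.
Qed.

Lemma lebesgue_outer0 : lebesgue_outer set0 = 0.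
Proof.
apply/eqP; rewrite eq_le lebesgue_outer_ge0 andbT.
apply: ereal_inf_lbound; exists (fun=> None) => //=.
by rewrite eseries0.
Qed.

Lemma le_lebesgue_outer :
  {homo lebesgue_outer : A B / A `<=` B >-> A <= B}.
Proof.
move=> A B AB; apply/ereal_inf_le_tmp => _ [I BI <-].
by exists I => //; exact: subset_trans AB BI.
Qed.

Lemma lebesgue_outer_sigma_subadditive : sigma_subadditive lebesgue_outer.
Proof.
move=> A; have [[i ioo]|] := pselect (exists i, lebesgue_outer (A i) = +oo).
  rewrite (eseries_pinfty _ _ ioo) ?leey// => n _.
  by rewrite -ltNye (lt_le_trans _ (lebesgue_outer_ge0 _)).
rewrite -forallNE => Aoo.
suff add2e (e : {posnum R}) :
    lebesgue_outer (\bigcup_n A n)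
      <= \sum_(i <oo) lebesgue_outer (A i) + e%:num%:E.
  by apply/lee_addgt0Pr => _/posnumP[].
rewrite (le_trans _ (epsilon_trick _ _ _))//; last first.
  by move=> n; exact: lebesgue_outer_ge0.
pose P n (B : nat -> option ('rV[R]_d * 'rV[R]_d)) := box_cover (A n) B /\
  \sum_(k <oo) box_volume (B k)
    <= lebesgue_outer (A n) + (e%:num / (2 ^ n.+1)%:R)%:E.
have [G PG] : {G : nat -> nat -> _ & forall n, P n (G n)}.
  apply: (@choice _ _ P) => n; rewrite /P /lebesgue_outer.
  set S := (X in ereal_inf X); move infS : (ereal_inf S) => iS.
  case: iS infS => [r Sr|Soo|Soo].
  - have en1 : (0 < e%:num / (2 ^ n.+1)%:R)%R by [].
    have /(lb_ereal_inf_adherent en1) : ereal_inf S \is a fin_num by rewrite Sr.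
    move=> [x [B AnB muBx] xS].
    by exists B; split => //; rewrite muBx -Sr; exact/ltW.
  - by have := Aoo n; rewrite /lebesgue_outer Soo.
  - have := lebesgue_outer_ge0 (A n).
    by rewrite /lebesgue_outer -/S Soo.
pose mu := box_volume.
have muG_ge0 x : 0 <= (mu \o uncurry G) x by exact: box_volume_ge0.
apply: (@le_trans _ _ (\esum_(i in setT) (mu \o uncurry G) i)).
  apply: ereal_inf_lbound => /=.
  have /card_esym/ppcard_eqP[f] := card_nat2.
  exists (uncurry G \o f).
    move=> t [i _] /(PG i).1 [j _ Bijt]; exists (f^-1%FUN (i, j)) => //=.
    by rewrite invK ?inE.
  rewrite -(esum_pred_image (mu \o uncurry G) _ xpredT) ?[fun=> _]set_true//.
  by rewrite image_eq.
rewrite (_ : esum _ _ = \sum_(i <oo) \sum_(j <oo ) mu (G i j)); last first.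
  pose J : nat -> set (nat * nat) := fun i => [set (i, j) | j in setT].
  rewrite (_ : setT = \bigcup_k J k); last first.
    by rewrite predeqE => -[a b]; split => // _; exists a => //; exists b.
  rewrite esum_bigcupT /=; last 2 first.
    - apply/trivIsetP => i j _ _ ij.
      rewrite predeqE => -[n m] /=; split => //= -[] [_] _ [<-{n} _].
      by move=> [m' _] [] /esym/eqP; rewrite (negbTE ij).
    - by move=> /= [n m]; exact: box_volume_ge0.
  rewrite -(image_id [set: nat]) -fun_true esum_pred_image//; last first.
    by move=> n _; apply: esum_ge0 => m _; exact: muG_ge0.
  apply: eq_eseriesr => /= j _.
  rewrite -(esum_pred_image (mu \o uncurry G) (pair j) predT)//=; last 2 first.
    - by move=> m _; exact: (muG_ge0 (j, m)).
    - by move=> ? ? _ _; exact: (@can_inj _ _ _ snd).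
  by congr esum; rewrite predeqE => -[a b]; split; move=> [i _ <-]; exists i.
apply: lee_lim.
- apply: is_cvg_nneseries => n *.
  by apply: nneseries_ge0 => m *; exact: (muG_ge0 (n, m)).
- apply: is_cvg_nneseries => n *; apply: adde_ge0 => //.
  exact: lebesgue_outer_ge0.
- by near=> n; apply: lee_sum => i _; exact: (PG i).2.
Unshelve. all: by end_near. Qed.

HB.instance Definition _ := isOuterMeasure.Build R 'rV[R]_d lebesgue_outer
  lebesgue_outer0 lebesgue_outer_ge0 le_lebesgue_outer
  lebesgue_outer_sigma_subadditive.

(* d-dimensional Lebesgue measure, on the sigma-algebra of the Lebesgue
   measurable (that is, Caratheodory measurable) subsets of R^d. *)
Definition lebesgue_rV : set (caratheodory_type lebesgue_outer) -> \bar R :=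
  lebesgue_outer.

Lemma lebesgue_rV_semi_sigma_additive : semi_sigma_additive lebesgue_rV.
Proof.
move=> F mF tF mUF; rewrite /lebesgue_rV.
exact: caratheodory_measure_sigma_additive.
Qed.

HB.instance Definition _ := isMeasure.Build _ _ _ lebesgue_rV
  lebesgue_outer0 lebesgue_outer_ge0 lebesgue_rV_semi_sigma_additive.

End lebesgue_rV.

Arguments lebesgue_rV : clear implicits.

Section ifs.
Context (R : realType) (d n : nat).

Definition is_attractor (f : 'I_n -> 'rV[R]_d -> 'rV[R]_d)
    (Lambda : set 'rV[R]_d) : Prop :=
  [/\ Lambda !=set0, compact Lambda &
      Lambda = \bigcup_(j : 'I_n) (f j @` Lambda)].

(* Sequences are indexed from 0: [eps i] stands for epsilon_(i+1). The
   iterated operator folds to the right, so it is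
   f_(eps 0) \o f_(eps 1) \o ... \o f_(eps (N - 1)). *)
Definition codings (f : 'I_n -> 'rV[R]_d -> 'rV[R]_d) (x : 'rV[R]_d)
    : set (nat -> 'I_n) :=
  [set eps | (\big[comp/id]_(0 <= i < N) f (eps i)) 0 @[N --> \oo] --> x].

Definition similarity (lambda : 'I_n -> R) (p : 'I_n -> 'rV[R]_d) (j : 'I_n)
    (x : 'rV[R]_d) : 'rV[R]_d :=
  lambda j *: x + (1 - lambda j) *: p j.

End ifs.

(* Main.v *)
(** If the pieces f_i(Lambda) overlapped only in null sets, then additivity and
    scaling would give L(Lambda) = (sum_j lambda_j^d) L(Lambda); hence some
    U = f_i(Lambda) /\ f_j(Lambda) with i <> j has positive measure. The set E
    of the points of Lambda lying in no f_w(U), w a finite word, is null by a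
    Vitali argument: E is covered by arbitrarily small copies f_w(Lambda), each
    of which contains the fixed proportion f_w(U) of points outside E. Off the
    null set of the points f_w(y) with y in E, every finite beginning of a
    coding can be continued until it reaches U, where the next digit can be
    chosen to be i or j; these choices form a binary tree of codings. *)

Require Import Defs.
From HB Require Import structures.
From mathcomp Require Import all_boot all_order all_algebra.
From mathcomp Require Import all_classical all_reals all_analysis.
From mathcomp Require Import ring lra.

Set Implicit Arguments.
Unset Strict Implicit.
Unset Printing Implicit Defensive.

Import Order.TTheory GRing.Theory Num.Theory.
Import numFieldNormedType.Exports.

Local Open Scope classical_set_scope.
Local Open Scope card_scope.
Local Open Scope ring_scope.

(** * Lebesgue outer measure: measurability of closed sets, behaviour under affine maps, null
    sets *)

Section lebesgue_outer_theory.
Context (R : realType) (d : nat).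
Implicit Types (A : set 'rV[R]_d) (a b : 'rV[R]_d).
Notation mu := (@lebesgue_outer R d).
Local Open Scope ereal_scope.

Lemma lebesgue_outer_box_le I : mu (box I) <= box_volume I.
Proof.
apply: ge_ereal_inf; exists (box_volume I) => //.
exists (fun k => if k == 0%N then I else None).
  by move=> x Ix; exists 0%N.
rewrite (@nneseriesD1 _ _ 0%N xpredT)//; last first.
  by move=> k _; exact: box_volume_ge0.
by rewrite eseries0 ?adde0// => k _ /= /negbTE ->.
Qed.

Lemma lebesgue_outer_norm_le_fin (M : R) :
  mu [set x | `|x| <= M]%R < +oo.
Proof.
(* Boxes are open on the left, so half-side [M] would miss points with a coordinate [- M]. *)
set a : 'rV[R]_d := const_mx (- (M + 1))%R.
set b : 'rV[R]_d := const_mx (M + 1)%R.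
apply: (@le_lt_trans _ _ (box_volume (Some (a, b)))); last exact: ltry.
apply: le_trans (lebesgue_outer_box_le _).
apply: le_lebesgue_outer => x /= xM i; rewrite !mxE.
have : (`|x 0%R i| <= M)%R.
  apply: le_trans xM; rewrite -[leRHS]/(mx_norm x) mx_normrE.
  exact: (le_bigmax _ _ (0%R, i)).
rewrite ler_norml => /andP[h1 h2].
by apply/andP; split; lra.
Qed.

Let row_upd (a : 'rV[R]_d) (i : 'I_d) (t : R) : 'rV[R]_d :=
  \row_j (if j == i then t else a 0 j)%R.

(** The two halves of a box cut by the hyperplane x_i = t. If the hyperplane misses the box, one
    half is empty, and the [Num.max 0] in [box_volume] gives it volume 0. *)
Let box_lower (i : 'I_d) (t : R) (I : option ('rV[R]_d * 'rV[R]_d)) :=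
  if I is Some (a, b) then Some (a, row_upd b i (Num.min (b 0 i) t))%R
  else None.

Let box_upper (i : 'I_d) (t : R) (I : option ('rV[R]_d * 'rV[R]_d)) :=
  if I is Some (a, b) then Some (row_upd a i (Num.max (a 0 i) t), b)%R
  else None.

Let box_volume_cut i t I :
  box_volume I = box_volume (box_lower i t I) + box_volume (box_upper i t I).
Proof.
case: I => [[a b]|]/=; last by rewrite adde0.
rewrite -EFinD; congr EFin.
rewrite (bigD1 i)//= [in RHS](bigD1 i)//= [X in (_ = _ + X)%R](bigD1 i)//=.
under [in X in (_ = X + _)%R]eq_bigr => j /negbTE ji do rewrite !mxE ji.
under [in X in (_ = _ + X)%R]eq_bigr => j /negbTE ji do rewrite !mxE ji.
rewrite !mxE eqxx -mulrDl; congr (_ * _)%R.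
move: (a 0%R i) (b 0%R i) => {}a {}b.
case: (leP b t) => bt; case: (leP a t) => at_; rewrite /Num.max;
  by do ![case: ifPn; rewrite -?leNgt => ?]; lra.
Qed.

(** Cutting each box of a cover of [X] at x_i = t yields covers of the two parts of [X] with the
    same total volume. *)
Lemma caratheodory_halfspace (i : 'I_d) (t : R) :
  mu.-caratheodory [set x | x 0 i <= t]%R.
Proof.
apply: le_caratheodory_measurable => X.
apply: le_ereal_inf_tmp => _ [I XI <-].
rewrite (eq_eseriesr (fun k _ => box_volume_cut i t (I k))).
rewrite nneseriesD; try by move=> k _ _; exact: box_volume_ge0.
apply: leeD; apply: ge_ereal_inf.
  exists (\sum_(k <oo) box_volume (box_lower i t (I k))) => //.
  exists (box_lower i t \o I) => // x [/XI[k _]].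
  case E : (I k) => [[a b]|]//= xab xt; exists k => //=; rewrite E /= => j.
  have /andP[ax xb] := xab j; rewrite ax !mxE/=.
  by case: eqVneq => [ji|]//; rewrite le_min -ji xb ji.
exists (\sum_(k <oo) box_volume (box_upper i t (I k))) => //.
exists (box_upper i t \o I) => // x [/XI[k _]].
case E : (I k) => [[a b]|]//= xab /negP; rewrite -ltNge => xt.
exists k => //=; rewrite E /= => j.
have /andP[ax xb] := xab j; rewrite xb andbT !mxE/=.
by case: eqVneq => [ji|]//; rewrite gt_max -ji ax ji.
Qed.

Lemma caratheodory_box I : mu.-caratheodory (box I).
Proof.
case: I => [[a b]|]; last exact: caratheodory_measurable_set0.
rewrite (_ : box _ = ~` \bigcup_(i : 'I_d)
    ([set x | x 0 i <= a 0 i]%R `|` ~` [set x | x 0 i <= b 0 i]%R)); last first.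
  apply/seteqP; split => x /=.
    move=> xab [i _ /=]; have /andP[] := xab i; rewrite ltNge => /negP.
    by move=> ? ? [].
  move=> xab i; rewrite ltNge; apply/andP; split.
    by apply/negP => h; apply: xab; exists i => //; left.
  by apply: contrapT => h; apply: xab; exists i => //; right.
apply: caratheodory_measurable_setC.
apply: (@countable_bigcupT_measurable _ (caratheodory_type mu)) => // i.
apply: caratheodory_measurable_setU; first exact: caratheodory_halfspace.
by apply: caratheodory_measurable_setC; exact: caratheodory_halfspace.
Qed.

Lemma caratheodory_open A : open A -> mu.-caratheodory A.
Proof.
move=> oA.
(* Boxes with rational centre and half-side 1/(k+1) form a countable family; those not inside [A]
   are replaced by the empty set. *)
pose rbox (qk : 'rV[rat]_d * nat) : set 'rV[R]_d :=
  let I := Some (map_mx (fun q => ratr q - qk.2.+1%:R^-1)%R qk.1,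
                 map_mx (fun q => ratr q + qk.2.+1%:R^-1)%R qk.1) in
  [set x | box I `<=` A /\ box I x].
have -> : A = \bigcup_qk rbox qk.
  apply/seteqP; split => [x Ax|x [qk _ /= [/[apply]]]//].
  have := oA; rewrite openE => /(_ _ Ax) /nbhs_ballP[e /= e0 xeA].
  (* Two points of one box differ by at most 2/(k+1) in each coordinate, so half-side below e/2
     keeps the box inside the ball around [x]. *)
  have e2 : (0 < e / 2)%R by rewrite divr_gt0.
  have [k] := ltr_add_invr e2; rewrite add0r => ke.
  have k0 : (0 < k.+1%:R^-1 :> R)%R by rewrite invr_gt0.
  have /choice[q qP] : forall i : 'I_d, exists q : rat,
      (ratr q \in `](x 0 i - k.+1%:R^-1)%R, (x 0 i + k.+1%:R^-1)%R[)%R.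
    by move=> i; apply: rat_in_itvoo; move: (k.+1%:R^-1)%R k0 => h h0; lra.
  exists (\row_i q i, k) => //=; split => [y /= yq|i].
    apply: xeA; split=> // i j; rewrite [i]ord1 /ball/= ltr_norml.
    have := yq j; have := qP j; rewrite !mxE in_itv/=.
    move: (k.+1%:R^-1)%R ke => h eh.
    by move=> /andP[? ?] /andP[? ?]; apply/andP; split; lra.
  have := qP i; rewrite !mxE in_itv/=.
  move: (k.+1%:R^-1)%R => h /andP[? ?].
  by apply/andP; split; lra.
apply: (@countable_bigcupT_measurable _ (caratheodory_type mu)) => // qk.
rewrite /rbox; set I := (X in box X).
have [IA|nIA] := pselect (box I `<=` A).
  rewrite (_ : [set _ | _] = box I); first exact: caratheodory_box.
  by apply/seteqP; split => // x [].
rewrite (_ : [set _ | _] = set0); first exact: caratheodory_measurable_set0.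
by apply/seteqP; split => // x [].
Qed.

Lemma caratheodory_closed A : closed A -> mu.-caratheodory A.
Proof.
move=> cA; rewrite -[A]setCK.
apply: caratheodory_measurable_setC; apply: caratheodory_open.
exact: closed_openC.
Qed.

Let lebesgue_outer_affine_le (l : R) b A : (0 < l)%R ->
  mu ((fun x => l *: x + b)%R @` A) <= (l ^+ d)%:E * mu A.
Proof.
move=> l0; have ld0 : (0 < l ^+ d)%R by rewrite exprn_gt0.
rewrite -lee_pdivrMl//; apply: le_ereal_inf_tmp => _ [I AI <-].
rewrite lee_pdivrMl//.
pose J k :=
  if I k is Some (u, v) then Some (l *: u + b, l *: v + b)%R else None.
have volJ k : box_volume (J k) = (l ^+ d)%:E * box_volume (I k).
  rewrite /J; case: (I k) => [[u v]|]/=; last by rewrite mule0.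
  rewrite -EFinM; congr EFin.
  rewrite -[in (l ^+ d)%R](card_ord d) -prodr_const -big_split/=.
  apply: eq_bigr => i _; rewrite !mxE maxr_pMr ?ltW// mulr0.
  by congr Num.max; ring.
rewrite -nneseriesZl; last by move=> k _; exact: box_volume_ge0.
apply: ge_ereal_inf; exists (\sum_(k <oo) box_volume (J k)); last first.
  by rewrite (eq_eseriesr (fun k _ => volJ k)).
exists J => // _ [x Ax <-].
have [k _ xIk] := AI _ Ax; exists k => //.
rewrite /J; case: (I k) xIk => [[u v]|]//= uxv i.
have /andP[ux xv] := uxv i; rewrite !mxE.
by rewrite ltrD2r ltr_pM2l// ux lerD2r ler_pM2l.
Qed.

(** The reverse inequality is the preceding bound for the inverse map, whose ratio is [l^-1]. *)
Lemma lebesgue_outer_affine (l : R) b A : (0 < l)%R ->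
  mu ((fun x => l *: x + b)%R @` A) = (l ^+ d)%:E * mu A.
Proof.
move=> l0; apply/eqP; rewrite eq_le lebesgue_outer_affine_le//=.
have ld0 : (0 < l ^+ d)%R by rewrite exprn_gt0.
rewrite -lee_pdivlMl// -exprVn.
set f := (fun x : 'rV[R]_d => l *: x + b)%R.
pose g (x : 'rV[R]_d) : 'rV[R]_d := (l^-1 *: x - l^-1 *: b)%R.
have gf : cancel f g.
  by move=> x; rewrite /g /f scalerDr scalerA mulVf ?gt_eqF// scale1r addrK.
rewrite -[X in mu X <= _](image_id A).
rewrite -[X in X @` A](_ : g \o f = _); last first.
  by apply/funext => x; exact: gf.
by rewrite -image_comp; apply: lebesgue_outer_affine_le; rewrite invr_gt0.
Qed.

(** Completeness: a set of outer measure 0 satisfies the Caratheodory condition, so it serves as its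
    own measurable null cover. *)
Lemma lebesgue_outer0_negligible A : mu A = 0 -> (lebesgue_rV R d).-negligible A.
Proof.
move=> A0; exists A; split => //.
apply: le_caratheodory_measurable => X.
have XA0 : mu (X `&` A) = 0.
  apply/eqP; rewrite eq_le lebesgue_outer_ge0 andbT -A0.
  by apply: le_lebesgue_outer; exact: subIsetr.
by rewrite [X in X + _]XA0 add0e; apply: le_lebesgue_outer; exact: subIsetl.
Qed.

Lemma lebesgue_outer_bigcup0 (I : countType) (D : set I)
    (F : I -> set 'rV[R]_d) :
  (forall i, D i -> mu (F i) = 0) -> mu (\bigcup_(i in D) F i) = 0.
Proof.
move=> F0; apply/eqP; rewrite eq_le lebesgue_outer_ge0 andbT.
pose G k := if unpickle k is Some i then
  if `[< D i >] then F i else set0 else set0.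
apply: (@le_trans _ _ (mu (\bigcup_k G k))).
  apply: le_lebesgue_outer => x [i Di Fix]; exists (pickle i) => //.
  by rewrite /G pickleK; case: asboolP.
apply: le_trans (lebesgue_outer_sigma_subadditive _) _.
rewrite eseries0// => k _ _; rewrite /G; case: unpickle => [i|].
  by case: asboolP => [/F0//|_]; exact: lebesgue_outer0.
exact: lebesgue_outer0.
Qed.

(** Split both [B] and the union along [A]: they have the same part outside [A], and this part
    carries all of [mu B]. *)
Lemma lebesgue_outerU A B : mu.-caratheodory A -> mu (A `&` B) = 0 ->
  mu (A `|` B) = mu A + mu B.
Proof.
move=> mA AB0; have := mA B; rewrite setIC => muB.
have {}muB : mu B = mu (B `&` ~` A) by rewrite [LHS]muB [X in X + _]AB0 add0e.
have := mA (A `|` B); rewrite setIUl setIid (setUidl (@subIsetr _ _ _)).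
by rewrite setIUl setICr set0U muB => ->.
Qed.

End lebesgue_outer_theory.

(** * Vitali selection from a finite family *)

Lemma seq_argmax (R : realDomainType) (I : eqType) (r : I -> R) (s : seq I) :
  s != [::] -> exists2 i, i \in s & forall j, j \in s -> r j <= r i.
Proof.
elim: s => // a s IH _; have [->|/IH[i is_ imax]] := eqVneq s [::].
  by exists a => [|j]; rewrite inE // => /eqP ->.
have [ai|ia] := leP (r a) (r i).
  exists i => [|j]; first by rewrite inE is_ orbT.
  by rewrite inE => /orP[/eqP ->//|/imax].
exists a => [|j]; first by rewrite inE eqxx.
by rewrite inE => /orP[/eqP ->//|/imax/le_trans->//]; exact: ltW.
Qed.

(* Greedy selection of the largest remaining set, as in Vitali's lemma. *)
Lemma vitali_selection (R : realDomainType) (I : choiceType) (T : Type)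
    (F : I -> set T) (r : I -> R) (s : seq I) :
  (forall i, F i !=set0) ->
  exists D : seq I, [/\ uniq D, {subset D <= s}, trivIset [set` D] F &
    forall i, i \in s -> exists2 j, j \in D &
      F i `&` F j !=set0 /\ r i <= r j].
Proof.
move=> F0; have [m] := ubnP (size s); elim: m s => // m IH s.
have [->|s0] := eqVneq s [::].
  by move=> _; exists [::]; split=> // i j; rewrite /= in_nil.
have [i si imax] := seq_argmax r s0 => sm.
pose meets j := `[< F j `&` F i !=set0 >].
(* As [F i] is nonempty, [i] itself is filtered out, so the remaining list is strictly shorter and
   the induction applies. *)
have ii : meets i by apply/asboolP; rewrite setIid.
have [|D [uD Ds tD DP]] := IH [seq j <- s | ~~ meets j].
  rewrite -ltnS; apply: leq_trans sm; rewrite ltnS size_filter.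
  rewrite -(count_predC meets s) -[X in (X < _)%N]add0n ltn_add2r.
  by rewrite -has_count; apply/hasP; exists i.
have Dmeets j : j \in D -> ~ (F j `&` F i !=set0).
  by move=> /Ds; rewrite mem_filter => /andP[/asboolPn].
exists (i :: D); split.
- rewrite /= uD andbT; apply/negP => /Dmeets; apply; exact/asboolP.
- move=> j; rewrite inE => /orP[/eqP ->//|/Ds].
  by rewrite mem_filter => /andP[].
- move=> j k; rewrite /= !inE => /orP[/eqP ->|jD] /orP[/eqP ->|kD] //.
  + by rewrite setIC => /Dmeets; rewrite kD => /(_ isT).
  + by move=> /Dmeets; rewrite jD => /(_ isT).
  + exact: tD.
- move=> j sj; case: (boolP (meets j)) => [/asboolP ji|ji].
    by exists i; [rewrite inE eqxx|split => //; exact: imax].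
  have [|k kD kP] := DP j; first by rewrite mem_filter ji.
  by exists k => //; rewrite inE kD orbT.
Qed.

Lemma affine_continuous (K : numFieldType) (V : normedModType K) (l : K)
  (b : V) : continuous (fun x => l *: x + b).
Proof. by move=> x; apply: cvgD; [exact: scaler_continuous|exact: cvg_cst]. Qed.

(** * Compositions of the similarities along finite words, and their action on the attractor *)

Section similarity_words.
Context (R : realType) (d n : nat).
Context (lambda : 'I_n -> R) (p : 'I_n -> 'rV[R]_d).
Hypothesis lambda01 : forall j, 0 < lambda j < 1.
Implicit Types (w : seq 'I_n) (x y : 'rV[R]_d).
Notation f := (similarity lambda p).
Notation mu := (@lebesgue_outer R d).

Definition sim_word w x := foldr f x w.

Definition ratio_word w := \prod_(j <- w) lambda j.

Lemma sim_word_cat w v x : sim_word (w ++ v) x = sim_word w (sim_word v x).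
Proof. exact: foldr_cat. Qed.

Lemma sim_wordE w x : sim_word w x = ratio_word w *: x + sim_word w 0.
Proof.
rewrite /ratio_word; elim: w => [|j w IH] /=.
  by rewrite big_nil scale1r addr0.
by rewrite big_cons IH {1 2}/similarity scalerDr scalerA addrA.
Qed.

Lemma sim_wordB w x y : sim_word w x - sim_word w y = ratio_word w *: (x - y).
Proof.
by rewrite sim_wordE [X in _ - X]sim_wordE opprD addrACA subrr addr0 scalerBr.
Qed.

Lemma ratio_word_gt0 w : 0 < ratio_word w.
Proof. by apply: prodr_gt0 => j _; have /andP[] := lambda01 j. Qed.

Lemma sim_word_inv w x : exists y, x = sim_word w y.
Proof.
exists ((ratio_word w)^-1 *: (x - sim_word w 0)).
by rewrite sim_wordE scalerA mulfV ?gt_eqF ?ratio_word_gt0// scale1r subrK.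
Qed.

Lemma lebesgue_outer_sim_word w (A : set 'rV[R]_d) :
  mu (sim_word w @` A) = ((ratio_word w ^+ d)%:E * mu A)%E.
Proof.
rewrite -(@lebesgue_outer_affine R d _ (sim_word w 0)) ?ratio_word_gt0//.
by congr (mu _); apply: eq_imagel => x _; exact: sim_wordE.
Qed.

Lemma compact_sim_word w (A : set 'rV[R]_d) :
  compact A -> compact (sim_word w @` A).
Proof.
move=> cA; apply: continuous_compact => //; apply: continuous_subspaceT.
rewrite (_ : sim_word w = fun x => ratio_word w *: x + sim_word w 0).
  exact: affine_continuous.
by apply/funext => x; exact: sim_wordE.
Qed.

Lemma ratio_word_le : exists2 c : R, 0 <= c < 1 &
  forall w, ratio_word w <= c ^+ size w.
Proof.
(* The largest ratio; the default 0 covers [n = 0]. *)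
exists (\big[Num.max/0]_j lambda j).
  rewrite bigmax_ge_id/=; apply: bigmax_lt => // j _.
  by have /andP[] := lambda01 j.
move=> w; rewrite /ratio_word; elim: w => [|j w IH].
  by rewrite big_nil expr0.
rewrite big_cons /= exprS; apply: ler_pM => //.
- by have /andP[/ltW] := lambda01 j.
- by apply/ltW; exact: ratio_word_gt0.
- exact: le_bigmax.
Qed.

Lemma ratio_word_small (e : R) : 0 < e ->
  exists N, forall w, (N <= size w)%N -> ratio_word w < e.
Proof.
move=> e0; have [c /andP[c0 c1] cP] := ratio_word_le.
have := @cvg_expr R c; rewrite ger0_norm// => /(_ c1).
move=> /cvgrPdist_lt /(_ _ e0)[N _ NP]; exists N => w Nw.
apply: le_lt_trans (cP w) _; have := NP _ Nw.
by rewrite /= sub0r normrN ger0_norm// exprn_ge0.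
Qed.

Section attractor.
Context (Lambda : set 'rV[R]_d).
Hypothesis attractorP : is_attractor f Lambda.

Lemma attractor_sim_word w x : Lambda x -> Lambda (sim_word w x).
Proof.
move=> Lx; elim: w => //= j w IH.
by have [_ _ ->] := attractorP; exists j => //; exists (sim_word w x).
Qed.

Lemma attractor_sim_word_inv N x : Lambda x ->
  exists w y, [/\ size w = N, Lambda y & x = sim_word w y].
Proof.
elim: N x => [|N IH] x Lx; first by exists [::], x.
have : (\bigcup_j (f j @` Lambda)) x by have [_ _ <-] := attractorP.
move=> [j _ [y Ly <-]]; have [w [z [sw Lz ->]]] := IH _ Ly.
by exists (j :: w), z; split => //=; rewrite sw.
Qed.

Lemma attractor_bounded : exists2 M : R, 0 < M & forall x, Lambda x -> `|x| <= M.
Proof.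
have [_ cL _] := attractorP.
have [M [Mr MP]] := compact_bounded cL.
exists (`|M| + 1) => [|x Lx]; first by rewrite ltr_wpDl.
by apply: MP => //; rewrite (le_lt_trans (ler_norm _))// ltrDl.
Qed.

Lemma attractor_lebesgue_fin : (mu Lambda < +oo)%E.
Proof.
have [M _ MP] := attractor_bounded.
apply: le_lt_trans (lebesgue_outer_norm_le_fin d M).
exact: le_lebesgue_outer.
Qed.

End attractor.
End similarity_words.

(** * Overlap of positive measure, and the null set of points avoiding all copies of a given compact
    set *)

Section overlap.
Context (R : realType) (d n : nat).
Context (lambda : 'I_n -> R) (p : 'I_n -> 'rV[R]_d).
Hypothesis lambda01 : forall j, 0 < lambda j < 1.
Context (Lambda : set 'rV[R]_d).
Notation f := (similarity lambda p).
Notation fw := (sim_word lambda p).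
Notation mu := (@lebesgue_outer R d).
Hypothesis attractorP : is_attractor f Lambda.
Local Open Scope ereal_scope.

Let compact_caratheodory (A : set 'rV[R]_d) :
  compact A -> measurable (A : set (caratheodory_type mu)).
Proof. by move=> cA; apply: caratheodory_closed; exact: compact_closed. Qed.

Let bigcup_cons (T : Type) (I : eqType) (i : I) (s : seq I) (F : I -> set T) :
  \bigcup_(j in [set` i :: s]) F j = F i `|` \bigcup_(j in [set` s]) F j.
Proof.
rewrite -bigcup_setU1; congr bigcup; apply/seteqP; split => j /=.
  by rewrite inE => /orP[/eqP ->|]; [left|right].
by rewrite inE => -[->|->]; rewrite ?eqxx ?orbT.
Qed.

Lemma attractor_overlap :
  0 < mu Lambda -> (\sum_(j < n) lambda j ^+ d != 1)%R ->
  exists i j, i != j /\ 0 < mu (f i @` Lambda `&` f j @` Lambda).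
Proof.
move=> L0 S1; apply: contrapT => noverlap.
have null i j : i != j -> mu (f i @` Lambda `&` f j @` Lambda) = 0.
  move=> ij; apply/eqP; rewrite eq_le lebesgue_outer_ge0 andbT leNgt.
  by apply/negP => ?; apply: noverlap; exists i, j.
have Lfin := attractor_lebesgue_fin attractorP.
have [_ cL LE] := attractorP.
have muf j : mu (f j @` Lambda) = (lambda j ^+ d)%:E * mu Lambda.
  have := lebesgue_outer_sim_word p lambda01 [:: j] Lambda.
  by rewrite /ratio_word big_seq1.
have mf j : measurable (f j @` Lambda : set (caratheodory_type mu)).
  apply: compact_caratheodory.
  exact: (@compact_sim_word _ _ _ lambda p [:: j]).
have muU s : uniq s -> mu (\bigcup_(j in [set` s]) (f j @` Lambda)) =
    (\sum_(j <- s) lambda j ^+ d)%:E * mu Lambda.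
  elim: s => [_|i s IH /= /andP[is_ us]].
    rewrite big_nil mul0e (_ : bigcup _ _ = set0) ?lebesgue_outer0//.
    by apply/seteqP; split => // x [].
  rewrite bigcup_cons big_cons.
  rewrite lebesgue_outerU; last 2 first.
  - exact: mf.
  - rewrite setI_bigcupr; apply: lebesgue_outer_bigcup0 => j /= js.
    by apply: null; apply: contraNneq is_ => ->.
  rewrite muf IH// EFinD ge0_muleDl// lee_fin ?exprn_ge0//.
    by rewrite ltW; have /andP[] := lambda01 i.
  by apply: sumr_ge0 => j _; rewrite exprn_ge0// ltW; have /andP[] := lambda01 j.
have := muU (index_enum 'I_n) (index_enum_uniq _).
rewrite (_ : bigcup _ _ = Lambda); last first.
  rewrite [RHS]LE; congr bigcup; apply/seteqP; split => // j _ /=.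
  exact: mem_index_enum.
(* [mu Lambda] is positive and finite, so it cancels and forces the sum to be 1. *)
move: L0 Lfin; case: (mu Lambda) => // r; rewrite lte_fin => r0 _.
rewrite -EFinM => -[] rE; move/eqP: S1; apply.
by apply: (mulIf (lt0r_neq0 r0)); rewrite mul1r.
Qed.

(** Each f_w multiplies the measures of [Q] and [U] by the same factor. Summing over [D],
    subadditivity suffices for the copies of [Q], and disjointness makes the measure additive on the
    copies of [U]. *)
Lemma disjoint_scaling_le (Q U : set 'rV[R]_d) (D : seq (seq 'I_n)) :
  compact U -> uniq D -> trivIset [set` D] (fun w => fw w @` U) ->
  mu U * mu (\bigcup_(w in [set` D]) (fw w @` Q)) <=
  mu Q * mu (\bigcup_(w in [set` D]) (fw w @` U)).
Proof.
move=> cU; elim: D => [_ _|w D IH /= /andP[wD uD] tD].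
  rewrite (_ : bigcup _ _ = set0) ?lebesgue_outer0 ?mule0.
    by rewrite mule_ge0// lebesgue_outer_ge0.
  by apply/seteqP; split => // x [].
have mfU v : measurable (fw v @` U : set (caratheodory_type mu)).
  apply: compact_caratheodory; exact: compact_sim_word.
rewrite !bigcup_cons.
rewrite [X in _ <= _ * X]lebesgue_outerU; last 2 first.
- exact: mfU.
- rewrite (_ : _ `&` _ = set0) ?lebesgue_outer0//.
  rewrite setI_bigcupr; apply/seteqP; split => // x [v /= vD xwv].
  have := tD w v; rewrite /= !inE eqxx vD orbT => /(_ isT isT).
  by move=> wv; move: wD; rewrite wv ?vD//; exists x.
rewrite ge0_muleDr ?lebesgue_outer_ge0//.
apply: (@le_trans _ _ (mu U * (mu (fw w @` Q) +
    mu (\bigcup_(i in [set` D]) [set fw i x | x in Q])))).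
  by apply: lee_wpmul2l; [exact: lebesgue_outer_ge0|exact: outer_measureU2].
rewrite ge0_muleDr ?lebesgue_outer_ge0//; apply: leeD; last first.
  by apply: IH => // u v uD' vD'; apply: tD; rewrite /= inE ?uD' ?vD' orbT.
by rewrite !lebesgue_outer_sim_word// muleCA [leRHS]muleCA (muleC (mu U)).
Qed.

(* Every selected f_j(Lambda) enlarges to f_j of the ball of radius 3M, which
   covers all the no larger f_i(Lambda) that meet it. *)
Lemma word_union_le (M : R) (U : set 'rV[R]_d) (s : seq (seq 'I_n)) :
  (forall x, Lambda x -> `|x| <= M)%R -> compact U -> U `<=` Lambda ->
  mu U * mu (\bigcup_(w in [set` s]) (fw w @` Lambda)) <=
  mu [set x | `|x| <= 3 * M]%R * mu (\bigcup_(w in [set` s]) (fw w @` U)).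
Proof.
move=> LM cU UL; have [[x0 Lx0] _ _] := attractorP.
have [D [uD Ds tD DP]] := @vitali_selection _ _ _ (fun w => fw w @` Lambda)
  (ratio_word lambda) s (fun w => ex_intro _ _ (imageP (fw w) Lx0)).
have fUL w : fw w @` U `<=` fw w @` Lambda by exact: image_subset.
apply: (@le_trans _ _ (mu U * mu (\bigcup_(w in [set` D])
    (fw w @` [set x | `|x| <= 3 * M]%R)))).
  apply: lee_wpmul2l; first exact: lebesgue_outer_ge0.
  apply: le_lebesgue_outer => _ [i /= si [a La <-]].
  have [j jD [[_ [[b Lb <-] [c Lc bc]]] rij]] := DP _ si; exists j => //.
  have [q aq] := sim_word_inv p lambda01 j (fw i a); exists q => //=.
  have rj0 := ratio_word_gt0 lambda01 j.
  (* With r the ratio and f_i(b) = f_j(c) the common point: r_j |q - c| = |f_i(a) - f_i(b)| = r_i |a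
     - b| <= r_j (2 M). *)
  have qc : (`|q - c| <= 2 * M)%R.
    rewrite -(ler_pM2l rj0) -{1}(gtr0_norm rj0) -normrZ -(sim_wordB lambda p) -aq bc.
    rewrite sim_wordB normrZ gtr0_norm ?ratio_word_gt0//.
    apply: ler_pM => //; first by rewrite ltW ?ratio_word_gt0.
    rewrite (le_trans (ler_normB _ _))// (_ : 2 * M = M + M)%R; last by ring.
    by rewrite lerD// LM.
  rewrite -(subrK c q) (le_trans (ler_normD _ _))//.
  by rewrite (_ : 3 * M = 2 * M + M)%R; [rewrite lerD// LM|ring].
apply: le_trans (disjoint_scaling_le _ cU uD _) _.
  move=> i j iD jD [x [/fUL ix /fUL jx]]; apply: tD => //; by exists x.
apply: lee_wpmul2l; first exact: lebesgue_outer_ge0.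
by apply: le_lebesgue_outer => x [w /Ds ws xw]; exists w.
Qed.

(** Enumerate the copies f_w(U) as [F k]; let [W m] be the union of the first [m] and [T m] the rest
    of their union. The Vitali bound gives [mu U * mu E <= mu Q * mu (T m)] for every [m], and the
    right side tends to 0. *)
Lemma attractor_avoid_null (U : set 'rV[R]_d) :
  compact U -> U `<=` Lambda -> 0 < mu U ->
  mu (Lambda `\` \bigcup_w (fw w @` U)) = 0.
Proof.
move=> cU UL U0; set E := Lambda `\` _.
have [M M0 LM] := attractor_bounded attractorP.
have Lfin := attractor_lebesgue_fin attractorP.
have [_ cL _] := attractorP.
set Q := [set x : 'rV[R]_d | `|x| <= 3 * M]%R.
have Qfin : mu Q \is a fin_num.
  rewrite ge0_fin_numE ?lebesgue_outer_ge0//.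
  exact: lebesgue_outer_norm_le_fin.
have Ufin : mu U \is a fin_num.
  rewrite ge0_fin_numE ?lebesgue_outer_ge0//.
  by apply: le_lt_trans Lfin; exact: le_lebesgue_outer.
pose F k : set 'rV[R]_d :=
  if @unpickle (seq 'I_n) k is Some w then fw w @` U else set0.
have cF k : compact (F k).
  rewrite /F; case: unpickle => [w|]; [exact: compact_sim_word|exact: compact0].
have fF w : fw w @` U = F (pickle w) by rewrite /F pickleK.
pose W m := \bigcup_(k < m) F k.
have cW m : closed (W m).
  by apply: closed_bigcup => [|k _]; [exact: finite_II|exact: compact_closed].
pose T m := \bigcup_k F k `\` W m.
have TL m : T m `<=` Lambda.
  move=> x [[k _]]; rewrite /F; case: unpickle => // w [y Uy <-] _.
  by apply: (attractor_sim_word attractorP); exact: UL.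
have mF k : measurable (F k : set (caratheodory_type mu)).
  exact: compact_caratheodory.
have mT m : measurable (T m : set (caratheodory_type mu)).
  apply: (@measurableD _ (caratheodory_type mu)).
    by apply: bigcup_measurable => k _; exact: mF.
  by apply: bigcup_measurable => k _; exact: mF.
(* The [T m] decrease to the empty set inside [Lambda], which has finite measure, so continuity from
   above applies. *)
have T0 : mu (T m) @[m --> \oo] --> 0.
  have IT0 : \bigcap_m T m = set0.
    apply/seteqP; split => // x xT; have [[k _ Fkx] _] := xT 0%N I.
    by have [_] := xT k.+1 I; apply; exists k => //=.
  rewrite -(lebesgue_outer0 R d) -IT0.
  apply: (@nonincreasing_cvg_mu _ _ _ (lebesgue_rV R d)) => //.
  - by apply: le_lt_trans Lfin; apply: le_lebesgue_outer; exact: TL.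
  - by rewrite IT0; exact: measurable0.
  - move=> a b ab; apply/subsetPset; apply: setDS => x [k /= ka Fkx].
    by exists k => //=; exact: leq_trans ab.
(* Images f_w(Lambda) that miss W m cover E, since W m is closed, and their
   part f_w(U) lies in T m. *)
have key m : mu U * mu E <= mu Q * mu (T m).
  pose A w := `[< fw w @` Lambda `&` W m = set0 >].
  (* [word_union_le] concerns finite lists: the words satisfying [A] are exhausted by those with
     code below [k], and the bound passes to the limit in [k]. *)
  pose s k := [seq w <- pmap (@pickle_inv (seq 'I_n)) (iota 0 k) | A w].
  have smem k w : w \in s k = A w && (pickle w < k)%N.
    rewrite mem_filter mem_pmap; congr andb; apply/mapP/idP => [[m']|wk].
      rewrite mem_iota add0n => mk wm'; have := @pickle_invK (seq 'I_n) m'.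
      by rewrite -wm' /= => ->.
    by exists (pickle w); rewrite ?mem_iota ?pickleK_inv.
  pose G k := \bigcup_(w in [set` s k]) (fw w @` Lambda).
  have mG k : measurable (G k : set (caratheodory_type mu)).
    apply: fin_bigcup_measurable => // w _; apply: compact_caratheodory.
    exact: compact_sim_word.
  have Gle k : mu U * mu (G k) <= mu Q * mu (T m).
    apply: le_trans (word_union_le (s k) LM cU UL) _.
    apply: lee_wpmul2l; first exact: lebesgue_outer_ge0.
    apply: le_lebesgue_outer => x [w /=]; rewrite smem => /andP[/asboolP wA _] xw.
    split; first by exists (pickle w) => //; rewrite -fF.
    move=> xW; suff : (fw w @` Lambda `&` W m) x by rewrite wA.
    by split => //; move: xw; exact: image_subset.
  have EG : E `<=` \bigcup_k G k.
    move=> x [Lx nUx].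
    have nWx : (~` W m) x.
      move=> [k _]; rewrite /F; case: unpickle => // w xw.
      by apply: nUx; exists w.
    have := closed_openC (cW m); rewrite openE => /(_ _ nWx).
    move=> /nbhs_ballP[e /= e0 xe].
    (* Two points of f_w(Lambda) are at distance at most 2 M times the ratio of [w]; below this
       threshold the copy containing [x] stays in the ball of radius [e], hence off [W m]. *)
    have eM0 : (0 < e / (2 * M))%R by rewrite divr_gt0// mulr_gt0.
    have [N NP] := ratio_word_small lambda01 eM0.
    have [w [y [sw Ly xy]]] := attractor_sim_word_inv attractorP N Lx.
    have Aw : A w.
      apply/asboolP/seteqP; split => // _ [[z Lz <-] Wz].
      have : ball x e (fw w z).
        rewrite -ball_normE /= xy sim_wordB normrZ gtr0_norm ?ratio_word_gt0//.
        have := NP w; rewrite sw leqnn => /(_ isT).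
        rewrite ltr_pdivlMr ?mulr_gt0//; apply: le_lt_trans.
        apply: ler_wpM2l; first by rewrite ltW ?ratio_word_gt0.
        rewrite (le_trans (ler_normB _ _))// (_ : 2 * M = M + M)%R; last by ring.
        by rewrite lerD// LM.
      by move/xe; apply.
    exists (pickle w).+1 => //; exists w; first by rewrite /= smem Aw/=.
    by rewrite xy; exists y.
  apply: (@le_trans _ _ (mu U * mu (\bigcup_k G k))).
    by apply: lee_wpmul2l; [exact: lebesgue_outer_ge0|exact: le_lebesgue_outer].
  have Gcvg : mu U * mu (G k) @[k --> \oo] --> mu U * mu (\bigcup_k G k).
    apply: cvgeZl => //.
    apply: (@nondecreasing_cvg_mu _ _ _ (lebesgue_rV R d)) => //.
    - by apply: bigcup_measurable => k _; exact: mG.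
    - move=> a b ab; apply/subsetPset => x [w /= wa xw]; exists w => //=.
      by move: wa; rewrite !smem => /andP[-> /leq_trans ->].
  by apply: cvge_to_le Gcvg _; apply: nearW => k; exact: Gle.
have := cvgeZl Qfin T0; rewrite mule0 => QT0.
have : mu U * mu E <= 0 by apply: cvge_to_ge QT0 _; apply: nearW => m; exact: key.
move=> UE; apply/eqP; rewrite eq_le lebesgue_outer_ge0 andbT.
by rewrite -(pmule_rle0 _ U0).
Qed.
End overlap.

(** * Cardinality of the set of codings: the upper bound, and a binary tree for the lower bound *)

(** A sequence is determined by its graph, a subset of the countable type [nat * 'I_n]. *)
Lemma card_le_nat_bool (n : nat) (A : set (nat -> 'I_n)) :
  A #<= [set: nat -> bool].
Proof.
apply/pcard_injP.
exists (fun eps m => if @unpickle (nat * 'I_n)%type m is Some (k, j)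
  then eps k == j else false).
move=> e1 e2 _ _ e12; apply/funext => k.
have := congr1 (fun g => g (pickle (k, e2 k))) e12.
by rewrite pickleK eqxx => /eqP.
Qed.

Section codings_tree.
Context (R : realType) (d n : nat).
Context (lambda : 'I_n -> R) (p : 'I_n -> 'rV[R]_d).
Hypothesis lambda01 : forall j, 0 < lambda j < 1.
Context (Lambda : set 'rV[R]_d).
Notation f := (similarity lambda p).
Notation fw := (sim_word lambda p).
Hypothesis attractorP : is_attractor f Lambda.

Lemma bigcomp_sim_word (eps : nat -> 'I_n) N x :
  (\big[comp/id]_(0 <= i < N) f (eps i)) x = fw (mkseq eps N) x.
Proof.
rewrite /index_iota subn0 /mkseq; elim: (iota 0 N) => [|i s IH].
  by rewrite big_nil.
by rewrite big_cons /= IH.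
Qed.

(** Composing along the first N digits brings 0 and a point of [Lambda] to a distance of at most [M]
    times the ratio of that prefix, which tends to 0. *)
Lemma coding_of_prefixes (eps : nat -> 'I_n) x :
  (forall N, exists2 y, Lambda y & x = fw (mkseq eps N) y) -> codings f x eps.
Proof.
move=> xP; have [M M0 LM] := attractor_bounded attractorP.
apply/cvgrPdist_lt => e e0.
have [N NP] := ratio_word_small lambda01 (divr_gt0 e0 M0).
exists N => // m /= Nm; have [y Ly ->] := xP m.
rewrite bigcomp_sim_word sim_wordB subr0 normrZ gtr0_norm ?ratio_word_gt0//.
have := NP (mkseq eps m); rewrite size_mkseq => /(_ Nm).
rewrite ltr_pdivlMr//; apply: le_lt_trans.
by apply: ler_wpM2l; [rewrite ltW ?ratio_word_gt0|exact: LM].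
Qed.

Section tree.
Variables (P : set 'rV[R]_d) (i j : 'I_n).
Hypothesis neq_ij : i != j.
Hypothesis P_Lambda : P `<=` Lambda.
Hypothesis P_branch : forall y, P y -> exists v y1 y2,
  [/\ P y1, P y2, y = fw (rcons v i) y1 & y = fw (rcons v j) y2].

(** A bit sequence [b] selects a path: at each branching point its next bit chooses the digit [i] or
    [j]. The resulting infinite words [eps b] are codings of [x] and are distinct for distinct
    [b]. *)
Lemma card_codings_ge (x : 'rV[R]_d) : P x ->
  [set: nat -> bool] #<= codings f x.
Proof.
move=> Px.
have /choice[g gP] : forall y, exists t : seq 'I_n * ('rV[R]_d * 'rV[R]_d),
    P y -> [/\ P t.2.1, P t.2.2, y = fw (rcons t.1 i) t.2.1 &
      y = fw (rcons t.1 j) t.2.2].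
  move=> y; have [/P_branch[v [y1 [y2 ?]]]|nP] := pselect (P y).
    by exists (v, (y1, y2)).
  by exists ([::], (y, y)).
(* A state is a pair of the word read so far and the point still to be coded; [stP] keeps [x] equal
   to the image of that point under that word. *)
pose next (c : bool) (s : seq 'I_n * 'rV[R]_d) := let t := g s.2 in
  (s.1 ++ rcons t.1 (if c then i else j), if c then t.2.1 else t.2.2).
pose fix st (b : nat -> bool) k :=
  if k is k'.+1 then next (b k') (st b k') else ([::], x).
have stP b k : [/\ P (st b k).2, x = fw (st b k).1 (st b k).2 &
    (k <= size (st b k).1)%N].
  elim: k => [|k [Pk xk kk]]; first by split.
  have [P1 P2 E1 E2] := gP _ Pk; split.
  - by rewrite /= /next /=; case: (b k).
  - rewrite /= /next /= sim_word_cat {1}xk; congr (fw _ _).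
    by case: (b k).
  - rewrite /= /next /= size_cat size_rcons addnS ltnS.
    by rewrite (leq_trans kk)// leq_addr.
have st_prefix b k m : (k <= m)%N -> prefix (st b k).1 (st b m).1.
  elim: m => [|m IH]; first by rewrite leqn0 => /eqP ->.
  rewrite leq_eqVlt => /orP[/eqP ->//|]; first exact: prefix_refl.
  rewrite ltnS => /IH /prefix_trans; apply; exact: prefix_prefix.
(* Each step appends at least one digit, so after [m.+1] steps position [m] is filled and the
   default [i] is not reached. *)
pose eps b m := nth i (st b m.+1).1 m.
have nth_st b k m : (m < size (st b k).1)%N -> nth i (st b k).1 m = eps b m.
  move=> mk; have m1 : (m < size (st b m.+1).1)%N by have [] := stP b m.+1.
  rewrite /eps; have [/(st_prefix b)|/ltnW/(st_prefix b)] := leqP k m.+1.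
    by move=> /prefixP[s ->]; rewrite nth_cat mk.
  by move=> /prefixP[s ->]; rewrite nth_cat m1.
have eps_codings b : codings f x (eps b).
  apply: coding_of_prefixes => N; have [PN xN sN] := stP b N.
  exists (fw (drop N (st b N).1) (st b N).2).
    by apply: (attractor_sim_word attractorP); exact: P_Lambda.
  rewrite -sim_word_cat (_ : mkseq _ _ = take N (st b N).1) ?cat_take_drop//.
  apply: (@eq_from_nth _ i); rewrite size_mkseq ?size_takel// => m mN.
  by rewrite nth_mkseq// nth_take// nth_st// (leq_trans mN).
have st_ext b b' k : (forall m, (m < k)%N -> b m = b' m) -> st b k = st b' k.
  elim: k => //= k IH bb'; rewrite IH ?bb'// => m mk.
  by rewrite bb'// (leq_trans mk).
have eps_inj : injective eps.
  move=> b b' bb'; apply/funext => k.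
  have [m] := ubnP k; elim: m k => // m IH k; rewrite ltnS => km.
  have stk : st b k = st b' k.
    by apply: st_ext => l lk; apply: IH; exact: leq_trans km.
  (* If the bits agree before [k], the states at [k] coincide. Both paths then append the same word,
     and bit [k] decides the digit at position [q], just after it. *)
  set q := size ((st b k).1 ++ (g (st b k).2).1).
  have branch c : st c k = st b k -> eps c q = if c k then i else j.
    move=> ck; rewrite -(@nth_st c k.+1) /= /next ck /=.
      by rewrite -rcons_cat nth_rcons ltnn eqxx.
    by rewrite -rcons_cat size_rcons.
  have := branch b erefl; rewrite bb' branch//.
  case: (b k); case: (b' k) => // /eqP; last by rewrite (negbTE neq_ij).
  by rewrite eq_sym (negbTE neq_ij).
apply: (@card_le_trans _ _ _ (range eps)).
  by have /card_eqPle[] := @inj_card_eq _ _ [set: nat -> bool] _ (in2W eps_inj).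
by apply: subset_card_le => _ [b _ <-].
Qed.

End tree.
End codings_tree.

(** * Points outside all images of the exceptional null set, and their branching *)

Theorem theorem1p2 (R : realType) (d n : nat)
    (lambda : 'I_n -> R) (p : 'I_n -> 'rV[R]_d) (Lambda : set 'rV[R]_d)
    (lambda01 : forall j, 0 < lambda j < 1)
    (attractorP : is_attractor (similarity lambda p) Lambda)
    (sum_neq1 : \sum_(j < n) lambda j ^+ d != 1)
    (Lambda_gt0 : (0 < lebesgue_rV R d Lambda)%E) :
  \forall x \ae lebesgue_rV R d, Lambda x ->
    codings (similarity lambda p) x #= [set: nat -> bool].
Proof.
have [i [j [ij U0]]] := attractor_overlap lambda01 attractorP Lambda_gt0 sum_neq1.
set U := _ `&` _ in U0.
have [_ cL _] := attractorP.
have UL : U `<=` Lambda.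
  by move=> _ [[y Ly <-] _]; exact: (attractor_sim_word attractorP [:: i]).
have cU : compact U.
  apply: compact_closedI; first exact: (@compact_sim_word _ _ _ _ _ [:: i]).
  apply: compact_closed; first exact: norm_hausdorff.
  exact: (@compact_sim_word _ _ _ _ _ [:: j]).
pose E := Lambda `\` \bigcup_w (sim_word lambda p w @` U).
have E0 : lebesgue_outer E = 0%E.
  exact: (attractor_avoid_null lambda01 attractorP).
pose N := \bigcup_w (sim_word lambda p w @` E).
have N0 : lebesgue_outer N = 0%E.
  apply: lebesgue_outer_bigcup0 => w _.
  by rewrite lebesgue_outer_sim_word// E0 mule0.
have := lebesgue_outer0_negligible N0; apply: negligibleS => x /=.
apply: contra_notP => nNx Lx; rewrite card_eq_le card_le_nat_bool/=.
(* The empty word gives that [E] lies in [N], so each point of [P] lies in some f_v(U). As [N] is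
   mapped into itself by every f_w, a point whose image under f_w is outside [N] is outside [N] too;
   so both continuations from U stay in [P]. *)
pose P : set 'rV[R]_d := Lambda `&` ~` N.
apply: (@card_codings_ge _ _ _ _ _ lambda01 _ attractorP P i j ij) => //.
  by move=> y [].
move=> y [Ly nNy].
have : (\bigcup_w (sim_word lambda p w @` U)) y.
  by apply: contrapT => nUy; apply: nNy; exists [::] => //; exists y.
move=> [v _ [u [[y1 Ly1 y1u] [y2 Ly2 y2u]] uy]].
have yE1 : y = sim_word lambda p (rcons v i) y1.
  by rewrite -cats1 sim_word_cat /= y1u.
have yE2 : y = sim_word lambda p (rcons v j) y2.
  by rewrite -cats1 sim_word_cat /= y2u.
have notN w z : y = sim_word lambda p w z -> ~ N z.
  move=> yz [v' _ [z' Ez' z'z]]; apply: nNy; exists (w ++ v') => //.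
  by exists z' => //; rewrite sim_word_cat z'z.
by exists v, y1, y2; split => //; split => //; [exact: notN yE1|exact: notN yE2].
Qed.
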